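(* Let $\mathcal{K}$ be a mean whose domain contains bounded sets only, and let $\hat{\mathcal{K}}$ be its extension. If $\mathcal{K}$ is base-monotone, then $\hat{\mathcal{K}}$ is base-monotone.
   Context: A (generalized) mean is a function $\mathcal{K}: Dom(\mathcal{K})\to\bar{\mathbb{R}}=\mathbb{R}\cup\{-\infty,+\infty\}$, where $Dom(\mathcal{K})$ is a collection of nonempty subsets of $\mathbb{R}$, with $\inf H\le\mathcal{K}(H)\le\sup H$ for all $H\in Dom(\mathcal{K})$ (so values on bounded sets are real). Standing assumption on the domain of the original mean $\mathcal{K}$: it is closed under finite unions and nonempty finite intersections, and if $H\in Dom(\mathcal{K})$ and $I$ is a (finite or infinite) interval with $H\cap I\neq\emptyset$ then $H\cap I\in Dom(\mathcal{K})$. Extension: let $\mathcal{K}$ be a mean whose domain contains bounded sets only. Let $\emptyset\neq H\subset\mathbb{R}$ be such that $H\cap[x,y]\in Dom(\mathcal{K})$ for all real $x\le y$ with $H\cap[x,y]\neq\emptyset$. Set $\hat{\mathcal{K}}(H)=\lim_{x\to-\infty,\,y\to+\infty}\mathcal{K}(H\cap[x,y])$ if this double limit (with $x,y$ tending independently) exists in $\bar{\mathbb{R}}$; $Dom(\hat{\mathcal{K}})$ consists of all such $H$ for which the limit exists. A mean $\mathcal{M}$ is base-monotone if for all disjoint $H_1,H_2$ with $H_1,H_2,H_1\cup H_2\in Dom(\mathcal{M})$ one has $\min\{\mathcal{M}(H_1),\mathcal{M}(H_2)\}\le\mathcal{M}(H_1\cup H_2)\le\max\{\mathcal{M}(H_1),\mathcal{M}(H_2)\}$.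 *)

(* Defs.v *)
From mathcomp Require Import all_boot all_order all_algebra.
From mathcomp Require Import all_classical all_reals all_analysis.
Import Order.TTheory GRing.Theory Num.Theory.
Import numFieldNormedType.Exports.

Set Implicit Arguments.
Unset Strict Implicit.
Unset Printing Implicit Defensive.

Local Open Scope classical_set_scope.
Local Open Scope ring_scope.

(* A mean is a partial function on sets of reals: [mean_val] is total, but its
   values outside [mean_dom] carry no meaning and are never constrained. *)
Record mean (R : realType) := Mean {
  mean_dom : set (set R);
  mean_val :> set R -> \bar R;
  mean_dom_nonempty : forall H, mean_dom H -> H !=set0;
  mean_bounds : forall H, mean_dom H ->
    (ereal_inf (EFin @` H) <= mean_val H <= ereal_sup (EFin @` H))%E }.

Definition admissible_dom (R : realType) (D : set (set R)) : Prop :=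
  [/\ forall A B, D A -> D B -> D (A `|` B),
      forall A B, D A -> D B -> A `&` B !=set0 -> D (A `&` B) &
      forall A (i : interval R), D A -> A `&` [set` i] !=set0 ->
        D (A `&` [set` i]) ].

Definition base_monotone (R : realType) (M : mean R) : Prop :=
  forall H1 H2 : set R, H1 `&` H2 = set0 ->
    mean_dom M H1 -> mean_dom M H2 -> mean_dom M (H1 `|` H2) ->
    (mine (M H1) (M H2) <= M (H1 `|` H2) <= maxe (M H1) (M H2))%E.

Section Extension.
Variables (R : realType) (K : mean R).

Definition trunc_val (H : set R) (p : R * R) : \bar R := K (H `&` `[p.1, p.2]).

(* The product filter lets the two endpoints tend to -oo and +oo
   independently. *)
Definition trunc_filter : set_system (R * R) :=
  filter_prod (ninfty_nbhs R) (pinfty_nbhs R).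

(* Convergence takes place in the extended reals, so the limits -oo and +oo
   are allowed. *)
Definition ext_dom : set (set R) := [set H |
  [/\ H !=set0,
      forall x y : R, x <= y -> H `&` `[x, y] !=set0 ->
        mean_dom K (H `&` `[x, y]) &
      cvg (trunc_val H @ trunc_filter) ] ].

Definition ext_val (H : set R) : \bar R := lim (trunc_val H @ trunc_filter).

Lemma ext_dom_nonempty H : ext_dom H -> H !=set0.
Proof. by case. Qed.

Lemma trunc_near_dom H : ext_dom H ->
  \forall p \near trunc_filter, mean_dom K (H `&` `[p.1, p.2]).
Proof.
move=> [[h Hh] HK _].
exists ([set x | x < h], [set y | h < y]).
  by split; [apply: nbhs_ninfty_lt; exact: num_real | apply: nbhs_pinfty_gt; exact: num_real].
move=> [x y] /= [xh hy]; apply: HK; first exact: (le_trans (ltW xh) (ltW hy)).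
by exists h; split => //=; rewrite in_itv /= (ltW xh) (ltW hy).
Qed.

Lemma ext_bounds H : ext_dom H ->
  (ereal_inf (EFin @` H) <= ext_val H <= ereal_sup (EFin @` H))%E.
Proof.
move=> DH; have [_ _ cvH] := DH; apply/andP; split.
  apply: (@cvge_ge _ _ _ _ (trunc_val H)) cvH.
  apply: filterS (trunc_near_dom DH) => p /mean_bounds/andP[+ _].
  by apply: le_trans; apply: ereal_inf_le_tmp; apply: image_subset => x [].
apply: (@cvge_le _ _ _ _ (trunc_val H)) cvH.
apply: filterS (trunc_near_dom DH) => p /mean_bounds/andP[_ Kp].
by apply: (le_trans Kp); apply: ereal_sup_le; apply: image_subset => x [].
Qed.

Definition extension : mean R := Mean ext_dom_nonempty ext_bounds.

End Extension.

(* Main.v *)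
Require Import Defs.
From mathcomp Require Import all_boot all_order all_algebra.
From mathcomp Require Import all_classical all_reals all_analysis.
Import Order.TTheory GRing.Theory Num.Theory.
Import numFieldNormedType.Exports.

Local Open Scope classical_set_scope.
Local Open Scope ring_scope.

(** For a window [x, y], the truncation of H1 `|` H2 is the union of the
    truncations of H1 and H2, which are again disjoint.  Once [x, y] is large
    enough for the truncations to be nonempty, all three lie in the domain of
    K, and base-monotonicity of K sandwiches [trunc_val K (H1 `|` H2)] between
    the pointwise minimum and maximum of [trunc_val K H1] and
    [trunc_val K H2] ([trunc_val_sandwich]).  Minimum and maximum are
    continuous on the extended reals, infinite values included, so the
    sandwich survives the passage to the limit. *)

Lemma cvg_mine {T : Type} {F : set_system T} {FF : Filter F} {R : realType}
    (f g : T -> \bar R) (a b : \bar R) :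
  f @ F --> a -> g @ F --> b ->
  mine (f x) (g x) @[x --> F] --> mine a b.
Proof.
by move=> fa gb; exact: (cvg_comp2 fa gb (@min_continuous _ (\bar R) (a, b))).
Qed.

Lemma cvg_maxe {T : Type} {F : set_system T} {FF : Filter F} {R : realType}
    (f g : T -> \bar R) (a b : \bar R) :
  f @ F --> a -> g @ F --> b ->
  maxe (f x) (g x) @[x --> F] --> maxe a b.
Proof.
by move=> fa gb; exact: (cvg_comp2 fa gb (@max_continuous _ (\bar R) (a, b))).
Qed.

Lemma trunc_val_sandwich {R : realType} (K : mean R) (H1 H2 : set R) :
  base_monotone K -> H1 `&` H2 = set0 ->
  ext_dom K H1 -> ext_dom K H2 -> ext_dom K (H1 `|` H2) ->
  \forall p \near @trunc_filter R,
    (mine (trunc_val K H1 p) (trunc_val K H2 p) <= trunc_val K (H1 `|` H2) p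
     <= maxe (trunc_val K H1 p) (trunc_val K H2 p))%E.
Proof.
move=> K_mono disj D1 D2 D12.
have FF : Filter (@trunc_filter R) by exact: filter_prod_filter.
apply: filterS3 (trunc_near_dom D1) (trunc_near_dom D2) (trunc_near_dom D12).
move=> p; rewrite /trunc_val setIUl; apply: K_mono.
by rewrite setIACA disj set0I.
Qed.

Theorem proposition4p12 (R : realType) (K : mean R)
  (K_dom : admissible_dom (mean_dom K))
  (K_bounded : forall H : set R, mean_dom K H -> bounded_set H)
  (K_mono : base_monotone K) :
  base_monotone (extension K).
Proof.
move=> H1 H2 disj D1 D2 D12.
have FF : ProperFilter (@trunc_filter R) by exact: filter_prod_proper.
have [_ _ cv1] := D1; have [_ _ cv2] := D2; have [_ _ cv12] := D12.
have sandwich := trunc_val_sandwich _ _ _ K_mono disj D1 D2 D12.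
(* Rewriting the bounds as limits turns both inequalities into comparisons of
   limits of eventually ordered functions. *)
rewrite /= /ext_val -(cvg_lim _ (cvg_mine _ _ _ _ cv1 cv2))//.
rewrite -(cvg_lim _ (cvg_maxe _ _ _ _ cv1 cv2))//.
apply/andP; split; apply: lee_lim => //.
- by apply/cvg_ex; eexists; exact: cvg_mine cv1 cv2.
- by apply: filterS sandwich => p /andP[].
- by apply/cvg_ex; eexists; exact: cvg_maxe cv1 cv2.
- by apply: filterS sandwich => p /andP[].
Qed.
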